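(* For any digraph $D$ of order $n$, $\gamma_{oso}(D)\le n-\delta^0(D)$.
   Context: Digraphs $D=(V,A)$ are finite, without loops or multiple arcs (pairs of opposite arcs allowed); $n=|V|$. $N^+(v)=\{w: vw\in A\}$, $N^-(v)=\{w: wv\in A\}$, $d^\pm(v)=|N^\pm(v)|$, $\delta^0(D)=\min_{v}\min\{d^+(v),d^-(v)\}$. A set $S\subseteq V$ is out-dominating if every $v\in V\setminus S$ has an in-neighbor in $S$. $S$ is an out-secure out-dominating set (OSODS) if $S$ is out-dominating and for every $v\in V\setminus S$ there is $u\in N^-(v)\cap S$ such that $(S\setminus\{u\})\cup\{v\}$ is out-dominating. $\gamma_{oso}(D)$ is the minimum size of an OSODS of $D$. *)

(* Defs.v *)
From mathcomp Require Import all_boot.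

Set Implicit Arguments.
Unset Strict Implicit.
Unset Printing Implicit Defensive.

(* A digraph on the finite vertex type V is an arc relation A : rel V, where  *)
(* A v w means that vw is an arc; loops are excluded by [irreflexive A].      *)
Section Digraph.

Variables (V : finType) (A : rel V).

Definition Nout (v : V) : {set V} := [set w | A v w].
Definition Nin (v : V) : {set V} := [set w | A w v].

Definition outdeg (v : V) : nat := #|Nout v|.
Definition indeg (v : V) : nat := #|Nin v|.

(* The neutral value #|V| exceeds every degree of a loopless digraph, so it   *)
(* affects the result only for the digraph without vertices (giving 0).       *)
Definition min_semideg : nat :=
  \big[minn/#|V|]_(v : V) minn (outdeg v) (indeg v).

Definition out_dominating (S : {set V}) : bool :=
  [forall v in ~: S, exists u in S, u \in Nin v].

Definition osods (S : {set V}) : bool :=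
  out_dominating S &&
  [forall v in ~: S, exists u in Nin v :&: S,
     out_dominating (v |: (S :\ u))].

(* The full vertex set is an OSODS, so the minimum below is over a nonempty   *)
(* family.                                                                    *)
Lemma osodsT : osods [set: V].
Proof.
by apply/andP; split; apply/forall_inP => v; rewrite setCT inE.
Qed.

Definition gamma_oso : nat := #|[arg min_(S < [set: V] | osods S) #|S|]|.

Lemma gamma_osoP :
  (exists2 S : {set V}, osods S & #|S| = gamma_oso) /\
  (forall S : {set V}, osods S -> gamma_oso <= #|S|).
Proof.
rewrite /gamma_oso; case: arg_minnP => [|S oS minS]; first exact: osodsT.
by split => //; exists S.
Qed.

End Digraph.

(* Main.v *)
Require Import Defs.
From mathcomp Require Import all_boot.

Set Implicit Arguments.
Unset Strict Implicit.
Unset Printing Implicit Defensive.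

(** Every set [S] with at most [δ⁰] vertices outside it is out-dominating: a
    vertex [v] outside [S] has at least [δ⁰] in-neighbours, and since [v] is not
    its own in-neighbour, fewer than [δ⁰] of them lie outside [S].  Swapping a
    vertex of [S] with one outside preserves cardinality, so every set of size
    [n - δ⁰] is in fact an OSODS. *)

Lemma min_semideg_le_indeg (V : finType) (A : rel V) (v : V) :
  min_semideg A <= indeg A v.
Proof.
apply: leq_trans (geq_minr (outdeg A v) _).
(* [#|V|] is not a unit of [minn] on all of [nat], so the bound goes by induction on the
   enumeration. *)
rewrite /min_semideg; have := mem_index_enum v.
elim: index_enum => // w s IHs; rewrite big_cons inE => /predU1P[<-|/IHs].
  exact: geq_minl.
exact/leq_trans/geq_minr.
Qed.

(** Guarantees that a set of exactly [min_semideg A] vertices exists. *)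
Lemma min_semideg_le_card (V : finType) (A : rel V) : min_semideg A <= #|V|.
Proof.
rewrite /min_semideg; elim/big_ind: _ => // [m n le_m _|v _].
  exact: leq_trans (geq_minl _ _) le_m.
exact: leq_trans (geq_minl _ _) (max_card _).
Qed.

Lemma out_dominating_of_card (V : finType) (A : rel V) (S : {set V}) :
  irreflexive A -> #|~: S| <= min_semideg A -> out_dominating A S.
Proof.
move=> irrA leS; apply/forall_inP => v vS; apply/exists_inP.
have [|u uN uS] := @subsetPn _ (Nin A v) (~: S) _; last first.
  by exists u; rewrite // inE negbK in uS.
(* In-neighbours all outside [S] would still miss [v], forcing [indeg A v < #|~: S|]. *)
apply/negP => sub.
have : Nin A v \proper ~: S.
  by apply/properP; split=> //; exists v; rewrite // inE irrA.
move/proper_card; apply/negP; rewrite -leqNgt.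
exact: leq_trans leS (min_semideg_le_indeg A v).
Qed.

Lemma osods_of_card (V : finType) (A : rel V) (S : {set V}) :
  irreflexive A -> #|~: S| <= min_semideg A -> osods A S.
Proof.
move=> irrA leS; have domS := out_dominating_of_card irrA leS.
rewrite /osods domS; apply/forall_inP => v vS.
have /exists_inP[u uS uN] := forall_inP domS v vS.
apply/exists_inP; exists u; first by rewrite inE uN.
apply: out_dominating_of_card => //.
have vSu : v \notin S :\ u by rewrite in_setD1 negb_and -in_setC vS orbT.
suff -> : #|~: (v |: S :\ u)| = #|~: S| by [].
by rewrite [LHS]cardsCs [RHS]cardsCs !setCK cardsU1 vSu [in RHS](cardsD1 u S) uS.
Qed.

Theorem theorem2p4 (V : finType) (A : rel V) (irrA : irreflexive A) :
  gamma_oso A <= #|V| - min_semideg A.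
Proof.
have [_ minA] := gamma_osoP A.
(* [T] is the set of vertices left out; its complement is the OSODS. *)
have [T cardT] : exists T : {set V}, #|T| = min_semideg A.
  have := min_semideg_le_card A; rewrite -cardsT => /card_geqP[s [us <- _]].
  by exists [set x in s]; rewrite cardsE; apply/card_uniqP.
have <- : #|~: T| = #|V| - min_semideg A by rewrite cardsCs setCK cardT.
by apply/minA/osods_of_card; rewrite ?setCK ?cardT.
Qed.
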